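(* Let $V\sim N(\mu,\Sigma)$ be a Gaussian random vector with positive definite covariance matrix $\Sigma$, let $a,c,c'$ be components of $V$ with $c\neq a$, $c'\neq a$, and let $Z$ be a (possibly empty) set of components of $V$ with $a,c,c'\notin Z$. If $c'$ is conditionally independent of $a$ given $\{c\}\cup Z$, then $$\rho^2_{ac'\mid Z}\le \rho^2_{ac\mid Z}.$$
   Context: For a Gaussian vector $V$ with positive definite covariance matrix $\Sigma$, for distinct components $u,v$ and a set $Z$ of components with $u,v\notin Z$, the squared partial correlation is $$\rho^2_{uv\mid Z}=\frac{(\sigma_{uv}-\Sigma_{uZ}\Sigma_{ZZ}^{-1}\Sigma_{Zv})^2}{(\sigma_{uu}-\Sigma_{uZ}\Sigma_{ZZ}^{-1}\Sigma_{Zu})(\sigma_{vv}-\Sigma_{vZ}\Sigma_{ZZ}^{-1}\Sigma_{Zv})},$$ where $\sigma_{uv}$ is the $(u,v)$ entry of $\Sigma$ and $\Sigma_{uZ}$, $\Sigma_{ZZ}$ etc. are the corresponding submatrices; for $Z=\emptyset$ the correction terms are absent. *)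

(* Defs.v *)
From HB Require Import structures.
From mathcomp Require Import all_boot all_order all_algebra.
From mathcomp Require Import all_classical all_reals all_analysis.

Set Implicit Arguments.
Unset Strict Implicit.
Unset Printing Implicit Defensive.

Import Order.TTheory GRing.Theory Num.Theory.

Local Open Scope classical_set_scope.
Local Open Scope ring_scope.

Definition posdefmx (R : realType) (n : nat) (Sigma : 'M[R]_n) : Prop :=
  Sigma^T = Sigma /\
  forall x : 'rV[R]_n, x != 0 -> 0 < (x *m Sigma *m x^T) 0 0.

(* The normal law of mean m and variance v.  normal_prob takes the standard
   deviation, and normal_prob m 0 is the uniform law on [0, 1], hence the
   separate degenerate case. *)
Definition gauss_law (R : realType) (m v : R) (B : set R) : \bar R :=
  if v == 0 then \d_m B else normal_prob m (Num.sqrt v) B.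

(* V ~ N(mu, Sigma): every linear combination sum_i t_i V_i has the normal law
   of mean t mu^T and variance t Sigma t^T. *)
Definition gaussian_vector (d : measure_display) (T : measurableType d)
    (R : realType) (P : probability T R) (n : nat)
    (V : 'I_n -> {RV P >-> R}) (mu : 'rV[R]_n) (Sigma : 'M[R]_n) : Prop :=
  forall (t : 'rV[R]_n) (B : set R), measurable B ->
    P ((fun x => \sum_(i < n) t 0 i * V i x) @^-1` B) =
    gauss_law ((t *m mu^T) 0 0) ((t *m Sigma *m t^T) 0 0) B.

Definition sigma_gen (d : measure_display) (T : measurableType d)
    (R : realType) (P : probability T R) (n : nat)
    (V : 'I_n -> {RV P >-> R}) (W : {set 'I_n}) : set (set T) :=
  <<s \bigcup_(i in [set` W]) g_sigma_algebra_preimage (V i) >>.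

(* f is a version of the conditional probability P(E | G). *)
Definition is_cond_prob (d : measure_display) (T : measurableType d)
    (R : realType) (P : probability T R) (G : set (set T)) (E : set T)
    (f : T -> R) : Prop :=
  [/\ forall B : set R, measurable B -> G (f @^-1` B),
      P.-integrable [set: T] (EFin \o f)
    & forall H : set T, G H ->
        (\int[P]_(x in H) (f x)%:E)%E = P (E `&` H)].

(* X and Y are conditionally independent given the sub-sigma-algebra G:
   P(X in A, Y in B | G) = P(X in A | G) P(Y in B | G) almost surely.
   Versions of these conditional probabilities always exist and are almost
   surely unique, so asking for the identity for some versions or for all
   versions is the same. *)
Definition cond_independent (d : measure_display) (T : measurableType d)
    (R : realType) (P : probability T R) (G : set (set T))
    (X Y : {RV P >-> R}) : Prop :=
  forall A B : set R, measurable A -> measurable B ->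
    exists f g h : T -> R,
      [/\ is_cond_prob P G (X @^-1` A) f,
          is_cond_prob P G (Y @^-1` B) g,
          is_cond_prob P G ((X @^-1` A) `&` (Y @^-1` B)) h
        & {ae P, forall x, h x = f x * g x}].

(* sigma_uv - Sigma_uZ Sigma_ZZ^-1 Sigma_Zv.  For Z = set0 the product runs
   through matrices of size 0, so the correction term vanishes. *)
Definition partial_cov (R : realType) (n : nat) (Sigma : 'M[R]_n)
    (Z : {set 'I_n}) (u v : 'I_n) : R :=
  let uZ := \row_(j < #|Z|) Sigma u (enum_val j) in
  let ZZ := \matrix_(i < #|Z|, j < #|Z|) Sigma (enum_val i) (enum_val j) in
  let Zv := \col_(i < #|Z|) Sigma (enum_val i) v in
  Sigma u v - (uZ *m invmx ZZ *m Zv) 0 0.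

Definition sq_partial_corr (R : realType) (n : nat) (Sigma : 'M[R]_n)
    (Z : {set 'I_n}) (u v : 'I_n) : R :=
  partial_cov Sigma Z u v ^+ 2 /
  (partial_cov Sigma Z u u * partial_cov Sigma Z v v).

(* Main.v *)
(* Suppose r is supported on {a, c} and Z, r_a = 1, and r V is uncorrelated with
   V_i for every i in W = {c} and Z.  Flipping the sign of e = r V - E(r V) does not change
   the law of u V + s e when u is supported on W, so
   E(sin(s e) cos(u V + theta)) = 0, and s -> 0 gives
   E(e cos(u V + theta)) = 0.  Every indicator of an event of sigma(V_W) is
   obtained from such cosines by linear combinations and bounded pointwise
   limits, hence E(e | V_W) = 0.  Conditional independence then yields
   E(e V_c') = 0, that is (r Sigma)_c' = 0.

   Taking for r the residual of a given Z minus its regression on the residual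
   of c given Z, this equality reads
   pcov(a, c') = pcov(a, c) pcov(c, c') / pcov(c, c), where pcov denotes the
   partial covariance given Z, and the inequality
   follows from pcov(c, c')^2 <= pcov(c, c) pcov(c', c'). *)
Require Import Defs.
From HB Require Import structures.
From mathcomp Require Import all_boot all_order all_algebra.
From mathcomp Require Import all_classical all_reals all_analysis.
From mathcomp Require Import measurable_realfun ring lra.
From mathcomp Require finmap.

Set Implicit Arguments.
Unset Strict Implicit.
Unset Printing Implicit Defensive.

Import Order.TTheory GRing.Theory Num.Theory.
Import numFieldNormedType.Exports.

Local Open Scope classical_set_scope.
Local Open Scope ring_scope.

(** * Integration of real-valued functions *)

Lemma normr_lim_le (R : realType) (u : nat -> R) (C l : R) :
  (forall n, `|u n| <= C) -> u @ \oo --> l -> `|l| <= C.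
Proof.
move=> uC ul; have ul' : `|u n| @[n --> \oo] --> `|l| by exact: cvg_norm.
have <- : lim (`|u n| @[n --> \oo]) = `|l| by exact: cvg_lim.
by apply: limr_le; [apply/cvg_ex; exists (`|l|) | exact: nearW].
Qed.

Section integral_lemmas.
Context {d : measure_display} {T : measurableType d} {R : realType}.
Variable P : {finite_measure set T -> \bar R}.
Implicit Types f g xi : T -> R.

Local Notation itg f := (P.-integrable [set: T] (EFin \o f)).

Lemma measurable_of_integrable f : itg f -> measurable_fun [set: T] f.
Proof. by move=> /(measurable_int P) /measurable_EFinP. Qed.

Lemma le_integrable_EFin f g : measurable_fun [set: T] f -> (forall x, `|f x| <= g x) ->
  itg g -> itg f.
Proof.
move=> mf fg ig; apply: (le_integrable measurableT) ig.
  exact/measurable_EFinP.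
by move=> x _ /=; rewrite lee_fin (le_trans (fg x))// ler_norm.
Qed.

Lemma integrable_cst_EFin (C : R) : itg (fun=> C).
Proof. exact: finite_measure_integrable_cst. Qed.

Lemma integrable_bounded f (C : R) : measurable_fun [set: T] f ->
  (forall x, `|f x| <= C) -> itg f.
Proof. by move=> mf fC; apply: (le_integrable_EFin mf fC); exact: integrable_cst_EFin. Qed.

Lemma integrableZ_EFin (a : R) f : itg f -> itg (fun x => a * f x).
Proof.
move=> itf; rewrite (_ : EFin \o _ = (fun x => a%:E * (EFin \o f) x)%E)//.
exact: integrableZl.
Qed.

Lemma integrableD_EFin f g : itg f -> itg g -> itg (fun x => f x + g x).
Proof.
move=> itf itg_; rewrite (_ : EFin \o _ = (EFin \o f) \+ (EFin \o g))%E//.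
exact: integrableD.
Qed.

Lemma integrableB_EFin f g : itg f -> itg g -> itg (fun x => f x - g x).
Proof.
move=> itf itg_; rewrite (_ : EFin \o _ = (EFin \o f) \- (EFin \o g))%E//.
exact: integrableB.
Qed.

Lemma integrable_norm_EFin f : itg f -> itg (fun x => `|f x|).
Proof. by move=> /integrable_norm. Qed.

Lemma integrableM_bounded xi f (C : R) : itg xi -> measurable_fun [set: T] f ->
  (forall x, `|f x| <= C) -> itg (fun x => xi x * f x).
Proof.
move=> ixi mf fC; apply: (le_integrable_EFin _ (g := fun x => C * `|xi x|)).
- by apply: measurable_funM => //; exact: measurable_of_integrable.
- by move=> x; rewrite normrM mulrC ler_wpM2r.
- by apply: integrableZ_EFin; exact: integrable_norm_EFin.
Qed.

Lemma dominated_cvg_Rintegral (f_ : nat -> T -> R) f g :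
  (forall n, measurable_fun [set: T] (f_ n)) ->
  (forall x, f_ ^~ x @ \oo --> f x) ->
  (forall n x, `|f_ n x| <= g x) -> itg g ->
  itg f /\ \int[P]_x f_ n x @[n --> \oo] --> \int[P]_x f x.
Proof.
move=> mf_ f_f f_g ig.
have mf : measurable_fun [set: T] f.
  by apply: (measurable_fun_cvg mf_) => x _; exact: f_f.
have [||||| itf _ cvf] := @dominated_convergence _ _ _ P _ measurableT
    (fun n => EFin \o f_ n) (EFin \o f) (EFin \o g).
- by move=> n; exact/measurable_EFinP.
- exact/measurable_EFinP.
- apply: aeW => x _; apply: cvg_EFin; last exact: f_f.
  by apply: nearW => n.
- exact: ig.
- by apply: aeW => x n _ /=; rewrite lee_fin.
split => //; apply: (@fine_cvg _ _ _ _ (fun n => \int[P]_x (f_ n x)%:E)%E).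
by rewrite fineK//; exact: integrable_fin_num.
Qed.

Lemma dominated_cvg_Rintegral_eq0 (f_ : nat -> T -> R) f g :
  (forall n, measurable_fun [set: T] (f_ n)) ->
  (forall x, f_ ^~ x @ \oo --> f x) ->
  (forall n x, `|f_ n x| <= g x) -> itg g ->
  (forall n, \int[P]_x f_ n x = 0) -> \int[P]_x f x = 0.
Proof.
move=> mf_ f_f f_g ig f0.
have [_] := dominated_cvg_Rintegral mf_ f_f f_g ig.
under eq_fun do rewrite f0.
by move=> /(cvg_lim (@Rhausdorff R)) <-; rewrite lim_cst.
Qed.

End integral_lemmas.
Arguments integrable_bounded {d T R P f} C.

(** * Closure under linear combinations and bounded pointwise limits *)

Section bounded_closure.
Context {T : Type} {R : realType}.
Implicit Types (S : set (T -> R)) (f g : T -> R).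

(** An inductive form of the functional monotone class: its induction principle transfers a property
    from the generators. The bound [C] is uniform in [n] and [x], so that dominated convergence
    applies. *)
Inductive bounded_closure S : set (T -> R) :=
| bounded_closure_gen f : S f -> bounded_closure S f
| bounded_closure_lin a f g : bounded_closure S f -> bounded_closure S g ->
    bounded_closure S (fun x => a * f x + g x)
| bounded_closure_lim (f_ : nat -> T -> R) (C : R) f :
    (forall n, bounded_closure S (f_ n)) -> (forall n x, `|f_ n x| <= C) ->
    (forall x, f_ ^~ x @ \oo --> f x) -> bounded_closure S f.

Variable S : set (T -> R).
Local Notation cl := (bounded_closure S).
Hypothesis S_bounded : forall f, S f -> exists C, forall x, `|f x| <= C.
Hypothesis S_mul : forall f g, S f -> S g -> cl (fun x => f x * g x).
Hypothesis S_one : cl (fun=> 1).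

Lemma bounded_closure_bounded f : cl f -> exists C, forall x, `|f x| <= C.
Proof.
elim=> {f} [f /S_bounded //|a f g _ [C Cf] _ [D Dg]|f_ C f _ _ Cf cf].
- exists (`|a| * C + D) => x; apply: (le_trans (ler_normD _ _)).
  by rewrite lerD// normrM ler_wpM2l.
- by exists C => x; exact: (normr_lim_le (u := f_ ^~ x)).
Qed.

(** Induction on [f], with an inner induction on [g] when [f] is a generator. A bound on the fixed
    factor keeps the products uniformly bounded in the limit rule. *)
Lemma bounded_closureM f g : cl f -> cl g -> cl (fun x => f x * g x).
Proof.
move=> clf clg; elim: clf => {f} [f Sf|a f h clf IHf clh IHh|f_ C f clf IHf Cf cf].
- elim: clg => {g} [g Sg|a g h clg IHg clh IHh|g_ C g clg IHg Cg cg].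
  + exact: S_mul.
  + rewrite (_ : (fun x => _) = fun x => a * (f x * g x) + f x * h x).
      exact: bounded_closure_lin.
    by apply/funext => x; ring.
  + have [D Df] := S_bounded Sf.
    apply: (@bounded_closure_lim _ (fun n x => f x * g_ n x) (D * C)) => //.
      by move=> n x; rewrite normrM ler_pM.
    by move=> x; apply: cvgMr; exact: cg.
- rewrite (_ : (fun x => _) = fun x => a * (f x * g x) + h x * g x).
    exact: bounded_closure_lin.
  by apply/funext => x; ring.
- have [D Dg] := bounded_closure_bounded clg.
  apply: (@bounded_closure_lim _ (fun n x => f_ n x * g x) (C * D)) => //.
    by move=> n x; rewrite normrM ler_pM.
  by move=> x; apply: cvgMl; exact: cf.
Qed.

Lemma bounded_closure_cst a : cl (fun=> a).
Proof.
rewrite (_ : (fun=> a) = fun x => (a - 1) * 1 + 1); last first.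
  by apply/funext => x; ring.
exact: bounded_closure_lin.
Qed.

Lemma bounded_closureZ a f : cl f -> cl (fun x => a * f x).
Proof.
move=> clf; rewrite (_ : (fun x => _) = fun x => a * f x + 0).
  by apply: bounded_closure_lin => //; exact: bounded_closure_cst.
by apply/funext => x; rewrite addr0.
Qed.

(** An odd polynomial preserving [[-1, 1]], with fixed points -1, 0 and 1; its iterates approximate
    the sign function by polynomials. *)
Definition smooth_step (v : R) := (3 * v - v ^+ 3) / 2.

Lemma normr_smooth_step v : `|v| <= 1 -> `|smooth_step v| <= 1.
Proof.
rewrite /smooth_step !ler_norml => /andP[v0 v1].
(* This product and the next are twice [1 - smooth_step v] and twice [1 + smooth_step v]. *)
have : 0 <= (v - 1) ^+ 2 * (v + 2) by rewrite mulr_ge0 ?sqr_ge0//; lra.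
have : 0 <= (v + 1) ^+ 2 * (2 - v) by rewrite mulr_ge0 ?sqr_ge0//; lra.
by nra.
Qed.

Lemma normr_iter_smooth_step n v : `|v| <= 1 -> `|iter n smooth_step v| <= 1.
Proof. by move=> v1; elim: n => //= n IH; exact: normr_smooth_step. Qed.

Lemma smooth_stepN v : smooth_step (- v) = - smooth_step v.
Proof. by rewrite /smooth_step; field. Qed.

Lemma iter_smooth_stepN n v :
  iter n smooth_step (- v) = - iter n smooth_step v.
Proof. by elim: n => //= n ->; rewrite smooth_stepN. Qed.

Lemma smooth_step_ge v : 0 <= v <= 1 -> v <= smooth_step v.
Proof.
rewrite /smooth_step => /andP[v0 v1].
have : 0 <= v * ((1 - v) * (1 + v)) by rewrite !mulr_ge0//; lra.
by nra.
Qed.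

(** The iterates increase and stay in [[v, 1]]. By continuity their limit is a fixed point, and 1 is
    the only positive one. *)
Lemma cvg_iter_smooth_step_gt0 v : 0 < v <= 1 ->
  iter n smooth_step v @[n --> \oo] --> (1 : R).
Proof.
move=> /andP[v0 v1].
have it01 n : v <= iter n smooth_step v <= 1.
  elim: n => [|n /andP[IH0 IH1]] /=; first by rewrite lexx.
  rewrite (le_trans IH0) ?smooth_step_ge//=; last by apply/andP; split; lra.
  rewrite (le_trans (ler_norm _))// normr_smooth_step// ger0_norm//; lra.
have nd : nondecreasing_seq (fun n => iter n smooth_step v).
  apply/nondecreasing_seqP => n /=; have /andP[? ?] := it01 n.
  by rewrite smooth_step_ge//; apply/andP; split; lra.
have ub n : iter n smooth_step v <= 1 by have /andP[] := it01 n.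
have cv : cvgn (fun n => iter n smooth_step v).
  by apply: nondecreasing_is_cvgn => //; exists 1 => _ [n _ <-].
set l := limn (fun n => iter n smooth_step v) in cv *.
have cvl : iter n smooth_step v @[n --> \oo] --> l by exact: cv.
have lv : v <= l.
  by apply: limr_ge => //; apply: nearW => n; have /andP[] := it01 n.
have cvl' : iter n.+1 smooth_step v @[n --> \oo] --> smooth_step l.
  rewrite /smooth_step /=; apply: cvgMl; apply: cvgB; first exact: cvgMr.
  apply: (@continuous_cvg _ _ _ _ _ (fun n => iter n smooth_step v)
    (fun x => x ^+ 3)) => //.
  exact: exprn_continuous.
have : smooth_step l = l.
  apply: (@cvg_unique _ (@Rhausdorff R)) cvl' _.
  by move: cvl; rewrite -(cvg_shiftS (fun n => iter n smooth_step v)).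
rewrite /smooth_step => fp.
suff l1 : l = 1 by move: cvl; rewrite l1.
have l0 : l != 0 by rewrite gt_eqF//; exact: lt_le_trans lv.
have : l * (1 - l) * (1 + l) = 0 by nra.
move=> /eqP; rewrite !mulf_eq0 (negbTE l0)/= => /orP[/eqP|/eqP]; nra.
Qed.

Lemma cvg_iter_smooth_step v : `|v| <= 1 ->
  iter n smooth_step v @[n --> \oo] --> Num.sg v.
Proof.
move=> v1; have [v0|v0|v0] := sgrP v.
- rewrite (_ : (fun n => _) = fun=> 0); first exact: cvg_cst.
  by apply/funext => n; elim: n => [|n /= ->]; rewrite /smooth_step ?v0//; field.
- by apply: cvg_iter_smooth_step_gt0; rewrite v0/=; move: v1; rewrite gtr0_norm.
- rewrite -(opprK v); under eq_fun do rewrite iter_smooth_stepN.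
  apply: cvgN; apply: cvg_iter_smooth_step_gt0.
  by rewrite oppr_gt0 v0/=; move: v1; rewrite ltr0_norm.
Qed.

(** Each iterate of [smooth_step] at [f] is a polynomial in [f], hence in the closure, and the
    iterates are bounded by 1. *)
Lemma bounded_closure_sg f : cl f -> (forall x, `|f x| <= 1) ->
  cl (fun x => Num.sg (f x)).
Proof.
move=> clf f1.
apply: (@bounded_closure_lim _ (fun n x => iter n smooth_step (f x)) 1).
- elim=> [//|n IH]; pose h x := iter n smooth_step (f x).
  rewrite (_ : (fun x => _) = fun x => 3 / 2 * h x + - 2^-1 * (h x * (h x * h x))).
    apply: bounded_closure_lin => //; apply: bounded_closureZ.
    by do 2 apply: bounded_closureM => //.
  by apply/funext => x; rewrite /= -/(h x) /smooth_step; field.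
- by move=> n x; exact: normr_iter_smooth_step.
- by move=> x; exact: cvg_iter_smooth_step.
Qed.

End bounded_closure.

(** * Events whose indicator lies in the closure *)

Section bounded_closure_sigma_algebra.
Context {T : Type} {R : realType}.
Variable S : set (T -> R).
Local Notation cl := (bounded_closure S).
Hypothesis S_bounded : forall f, S f -> exists C, forall x, `|f x| <= C.
Hypothesis S_mul : forall f g, S f -> S g -> cl (fun x => f x * g x).
Hypothesis S_one : cl (fun=> 1).

(** Complements are affine combinations with 1. A countable union is the complement of a countable
    intersection, whose indicator is the bounded limit of finite products of indicators. *)
Lemma bounded_closure_sigma_algebra :
  sigma_algebra [set: T] [set H | cl \1_H].
Proof.
have clC A : cl \1_A -> cl \1_(~` A).
  move=> clA; rewrite (_ : \1_(~` A) = fun x => -1 * \1_A x + 1).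
    exact: bounded_closure_lin.
  apply/funext => x; rewrite !indicE in_setC.
  by case: (x \in A) => /=; ring.
split => /=.
- rewrite (_ : \1_set0 = fun=> 0); first exact: bounded_closure_cst.
  by apply/funext => x; rewrite indicE in_set0.
- by move=> A clA; rewrite setTD; exact: clC.
- move=> A clA; rewrite -(setCK (\bigcup_k A k)); apply: (clC).
  pose f n (x : T) : R := \prod_(k < n) \1_(~` A k) x.
  have f01 n x : f n x = (x \in \bigcap_(k < n) ~` A k)%:R.
    rewrite /f; apply/esym; have [xA|xA] := boolP (x \in _).
      rewrite big1// => k _; rewrite indicE mem_set//.
      by move: xA; rewrite inE => /(_ k (ltn_ord k)).
    have : exists2 k, (k < n)%N & A k x.
      apply: contrapT => xA'; move/negP: xA; apply; rewrite inE => k /= kn Akx.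
      by apply: xA'; exists k.
    move=> [k kn Akx]; rewrite (bigD1 (Ordinal kn))//= indicE memNset ?mul0r//.
  apply: (@bounded_closure_lim _ _ _ f 1).
  + elim=> [|n IH].
      suff -> : f 0%N = fun=> 1 by exact: S_one.
      by apply/funext => x; rewrite /f big_ord0.
    rewrite (_ : f n.+1 = fun x => f n x * \1_(~` A n) x).
      by apply: bounded_closureM => //; exact: clC.
    by apply/funext => x; rewrite /f big_ord_recr.
  + by move=> n x; rewrite f01; case: (_ \in _); rewrite ?normr1// normr0.
  + move=> x; apply: cvg_near_cst; rewrite indicE.
    have [xA|xA] := boolP (x \in _).
      apply: nearW => n; rewrite f01 mem_set// => k _ Akx.
      by move: xA; rewrite inE; apply; exists k.
    move: xA; rewrite notin_setE => /contrapT [k _ Akx].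
    exists k.+1 => // n /= kn; rewrite f01 memNset// => /(_ k kn).
    by move=> /(_ Akx).
Qed.

Variable k : T -> R.
Hypothesis cl_cos : forall s theta, cl (fun x => cos (s * k x + theta)).

(* The square waves sgn(sin(s (k - theta))), s > 0, converge to
   sgn(k - theta) as s tends to 0. *)
Lemma bounded_closure_sg_shift theta : cl (fun x => Num.sg (k x - theta)).
Proof.
pose s n : R := n.+1%:R^-1.
apply: (@bounded_closure_lim _ _ _
  (fun n x => Num.sg (sin (s n * (k x - theta)))) 1).
- move=> n; apply: bounded_closure_sg => //.
    rewrite (_ : (fun x => _) = (fun x => cos (s n * k x + (- (s n * theta) - pi / 2)))).
      exact: cl_cos.
    by apply/funext => x; rewrite addrA cosBpihalf mulrBr.
  by move=> x; rewrite ler_norml sin_geN1 sin_le1.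
- by move=> n x; rewrite normr_sg; case: (_ != _).
- move=> x; apply: cvg_near_cst; set u := k x - theta.
  have su : s n * u @[n --> \oo] --> 0 * u.
    by apply: cvgMl; exact: cvg_harmonic.
  (* The sine is positive on the open interval from 0 to 2, so below this bound it has the sign of
     its argument. For fixed [x] the sequence is thus eventually constant. *)
  have su2 : \forall n \near \oo, `|s n * u| < 2.
    rewrite mul0r in su.
    have := @cvgr0_norm_lt _ _ _ _ _ _ su 2 ltac:(by []).
    exact.
  have s0 n : 0 < s n by rewrite invr_gt0.
  near=> n.
  have sgsu : Num.sg (s n * u) = Num.sg u by rewrite sgrM gtr0_sg// mul1r.
  rewrite -sgsu; have : `|s n * u| < 2 by near: n.
  have [v0|v0|v0] := sgrP (s n * u).
  + by rewrite v0 sin0 sgr0.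
  + by move=> v2; rewrite gtr0_sg// sin2_gt0// v0.
  + move=> v2; rewrite ltr0_sg// -oppr_gt0 -sinN sin2_gt0//.
    by rewrite oppr_gt0 v0.
Unshelve. all: by end_near. Qed.

(** The sets [B] with this property form a sigma-algebra, so it suffices to treat the open rays that
    generate the Borel sets. *)
Lemma bounded_closure_preimage (B : set R) : measurable B ->
  cl \1_(k @^-1` B).
Proof.
have [c0 cC cU] := bounded_closure_sigma_algebra.
move=> mB; have : (@RGenOInfty.G R).-sigma.-measurable B.
  by rewrite -RGenOInfty.measurableE.
apply: (@smallest_sub _ _ _ [set B | cl \1_(k @^-1` B)]) => [|_ [t ->]] /=.
- split => /=.
  + by rewrite preimage_set0.
  + by move=> A /cC /=; rewrite !setTD preimage_setC.
  + by move=> F /cU /=; rewrite preimage_bigcup.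
(* [(g + g ^+ 2) / 2] is 1 where [g] is 1 and 0 where [g] is 0 or -1, which is the indicator of the
   open ray. *)
- pose g x := Num.sg (k x - t).
  have clg : cl g by exact: bounded_closure_sg_shift.
  rewrite (_ : \1_ _ = fun x => 2^-1 * (1 * g x + g x * g x)).
    apply: bounded_closureZ => //; apply: bounded_closure_lin => //.
    exact: bounded_closureM.
  apply/funext => x; rewrite indicE /g.
  have -> : (x \in k @^-1` `]t, +oo[) = (t < k x).
    by apply/idP/idP; rewrite inE /= in_itv/= andbT.
  have [kt|kt|->] := ltgtP (k x) t.
  + by rewrite ltr0_sg ?subr_lt0//=; field.
  + by rewrite gtr0_sg ?subr_gt0//=; field.
  + by rewrite subrr sgr0 /=; field.
Qed.

End bounded_closure_sigma_algebra.

(** * Orthogonality tested on cosines *)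

Section fourier.
Context {d : measure_display} {T : measurableType d} {R : realType}.
Variables (P : {finite_measure set T -> \bar R}) (n : nat).
Variables (V : 'I_n -> T -> R) (W : {set 'I_n}) (xi : T -> R).

Lemma Rintegral_bounded_closure (S : set (T -> R)) :
  (forall f, S f -> measurable_fun [set: T] f) ->
  (forall f, S f -> exists C, forall x, `|f x| <= C) ->
  P.-integrable [set: T] (EFin \o xi) ->
  (forall f, S f -> \int[P]_x (xi x * f x) = 0) ->
  forall f, bounded_closure S f -> \int[P]_x (xi x * f x) = 0.
Proof.
move=> mS bS ixi S0 f clf.
have mxi := measurable_of_integrable ixi.
(* Measurability is carried along the induction, since linearity and dominated convergence both call
   for it. *)
suff : measurable_fun [set: T] f /\ \int[P]_x (xi x * f x) = 0 by case.
elim: clf => {f} [f Sf|a f g clf [mf f0] clg [mg g0]|f_ C f clf IH Cf cf].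
- by split; [exact: mS|exact: S0].
- split; first by apply: measurable_funD => //; exact: measurable_funM.
  have [C Cf] := bounded_closure_bounded bS clf.
  have [D Dg] := bounded_closure_bounded bS clg.
  have itf := integrableM_bounded ixi mf Cf.
  have itg_ := integrableM_bounded ixi mg Dg.
  transitivity (\int[P]_x (a * (xi x * f x) + xi x * g x)).
    by apply: eq_Rintegral => x _; ring.
  rewrite RintegralD//; last exact: integrableZ_EFin.
  by rewrite RintegralZl// f0 g0 mulr0 addr0.
- split; first by apply: (measurable_fun_cvg (fun m => (IH m).1)) => x _.
  apply: (dominated_cvg_Rintegral_eq0 (f_ := fun m x => xi x * f_ m x)
    (g := fun x => C * `|xi x|)).
  + by move=> m; apply: measurable_funM => //; case: (IH m).
  + by move=> x; apply: cvgMr; exact: cf.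
  + by move=> m x; rewrite normrM mulrC ler_wpM2r.
  + by apply: integrableZ_EFin; exact: integrable_norm_EFin.
  + by move=> m; case: (IH m).
Qed.

Let wsum (w : 'I_n -> R) x := \sum_(i in W) w i * V i x.

(** The cosines contain 1 and their products are combinations of cosines, so their closure contains
    the indicators of a sigma-algebra. This one contains every preimage under [V i], [i \in W], and
    orthogonality to cosines passes to the closure. *)
Lemma fourier_orthogonal (H : set T) :
  (forall i, measurable_fun [set: T] (V i)) ->
  P.-integrable [set: T] (EFin \o xi) ->
  (forall w theta, \int[P]_x (xi x * cos (wsum w x + theta)) = 0) ->
  <<s \bigcup_(i in [set` W]) g_sigma_algebra_preimage (V i) >> H ->
  \int[P]_x (xi x * \1_H x) = 0.
Proof.
move=> mV ixi xi0 GH.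
pose S : set (T -> R) :=
  [set f | exists w theta, f = fun x => cos (wsum w x + theta)].
have S_bounded f : S f -> exists C, forall x, `|f x| <= C.
  by move=> [w [theta ->]]; exists 1 => x; rewrite ler_norml cos_geN1 cos_le1.
have S_mul f g : S f -> S g -> bounded_closure S (fun x => f x * g x).
  move=> [w [theta ->]] [v [eta ->]].
  pose h x := cos (wsum (w \+ v) x + (theta + eta)).
  pose h' x := cos (wsum (w \- v) x + (theta - eta)).
  have wsumD x : wsum (w \+ v) x = wsum w x + wsum v x.
    by rewrite /wsum -big_split; apply: eq_bigr => i _ /=; rewrite mulrDl.
  have wsumB x : wsum (w \- v) x = wsum w x - wsum v x.
    by rewrite /wsum -sumrB; apply: eq_bigr => i _ /=; rewrite mulrBl.
  have Sh : S h by exists (w \+ v), (theta + eta).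
  have Sh' : S h' by exists (w \- v), (theta - eta).
  (* The product-to-sum formula [(h + h') / 2], with [h' / 2] written as [- h' / 2 + h'] to fit the
     linear rule of the closure. *)
  rewrite (_ : (fun x => _) = fun x => 2^-1 * h x + (- 2^-1 * h' x + h' x)).
    by do 2 (apply: bounded_closure_lin; first exact: bounded_closure_gen);
      exact: bounded_closure_gen.
  apply/funext => x; rewrite /h /h' wsumD wsumB.
  rewrite (_ : _ + wsum v x + _ = wsum w x + theta + (wsum v x + eta)); last by ring.
  rewrite (_ : _ - wsum v x + _ = wsum w x + theta - (wsum v x + eta)); last by ring.
  move: (wsum w x + theta) (wsum v x + eta) => a b.
  by rewrite cosD cosB; field.
have S_one : bounded_closure S (fun=> 1).
  apply: bounded_closure_gen; exists (fun=> 0), 0; apply/funext => x.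
  by rewrite /wsum big1 ?addr0 ?cos0// => i _; rewrite mul0r.
have mS f : S f -> measurable_fun [set: T] f.
  move=> [w [theta ->]]; apply: (measurableT_comp (f := cos)).
    by apply: continuous_measurable_fun; exact: continuous_cos.
  apply: measurable_funD => //.
  rewrite (_ : wsum w = fun x => \sum_(i <- enum W) w i * V i x).
    by apply: measurable_sum => i; exact: measurable_funM.
  by apply/funext => x; rewrite big_enum.
have [c0 cC cU] := bounded_closure_sigma_algebra S_bounded S_mul S_one.
apply: (Rintegral_bounded_closure mS S_bounded ixi).
  by move=> f [w [theta ->]]; exact: xi0.
apply: (@smallest_sub _ _ _ [set H | bounded_closure S \1_H]) H GH => //.
move=> _ [i iW [B mB <-]] /=; rewrite setTI.
apply: bounded_closure_preimage => // s theta; apply: bounded_closure_gen.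
(* The weight concentrated at [i] reduces [wsum] to [s * V i]. *)
exists (fun j => if j == i then s else 0), theta; apply/funext => x.
rewrite /wsum (bigD1 i)//= eqxx big1 ?addr0// => j /andP[_ /negbTE ->].
by rewrite mul0r.
Qed.

End fourier.

Section orthogonality.
Context {d : measure_display} {T : measurableType d} {R : realType}.
Variables (P : {finite_measure set T -> \bar R}).

Import HBSimple.

(** [k] may be unbounded, hence outside the closure. It is approximated by simple functions of [k],
    which lie in the closure, and dominated convergence concludes. *)
Lemma Rintegral_orthogonal (xi k : T -> R) :
  measurable_fun [set: T] k ->
  P.-integrable [set: T] (EFin \o xi) ->
  P.-integrable [set: T] (EFin \o (fun x => xi x * k x)) ->
  (forall B, measurable B -> \int[P]_x (xi x * \1_(k @^-1` B) x) = 0) ->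
  \int[P]_x (xi x * k x) = 0.
Proof.
move=> mk ixi ixik xi0.
pose S : set (T -> R) := [set f | exists2 B, measurable B & f = \1_(k @^-1` B)].
have mS f : S f -> measurable_fun [set: T] f.
  by move=> [B mB ->]; apply: measurable_indic; rewrite -[_ @^-1` _]setTI; exact: mk.
have S_bounded f : S f -> exists C, forall x, `|f x| <= C.
  by move=> [B _ ->]; exists 1 => x; rewrite indicE; case: (_ \in _); rewrite ?normr1 ?normr0.
have S_one : bounded_closure S (fun=> 1).
  apply: bounded_closure_gen; exists [set: R] => //.
  by rewrite preimage_setT indicT.
have cl0 f : bounded_closure S f -> \int[P]_x (xi x * f x) = 0.
  by apply: Rintegral_bounded_closure => // _ [B mB ->]; exact: xi0.
have mid : measurable_fun [set: R] (EFin \o (fun y : R => y)).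
  by apply/measurable_EFinP.
have [g_ g_cvg] := approximation_sfun measurableT mid.
(* Restricting [g_ n] to the points where it is within 1 of the identity gives the domination
   [|h n| <= |k| + 1]; each point lies in [A n] eventually, so the limit is unchanged. *)
pose A n : set R := [set y | `|g_ n y - y| <= 1].
have mA n : measurable (A n).
  rewrite -[A n]setTI; apply: measurable_fun_le => //.
  by apply: measurableT_comp => //; exact: measurable_funB.
pose h n x : R := g_ n (k x) * \1_(A n) (k x).
have clh n : bounded_closure S (h n).
  rewrite (_ : h n = fun x => \sum_(r <- finmap.enum_fset (fset_set (range (g_ n))))
      r * \1_(k @^-1` (g_ n @^-1` [set r] `&` A n)) x).
    elim: (finmap.enum_fset (fset_set (range (g_ n)))) => [|r s IH].
      rewrite (_ : (fun x => _) = fun=> 0); last by apply/funext => x; rewrite big_nil.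
      exact: bounded_closure_cst.
    under eq_fun do rewrite big_cons.
    apply: bounded_closure_lin => //; apply: bounded_closure_gen.
    by exists (g_ n @^-1` [set r] `&` A n) => //; exact: measurableI.
  apply/funext => x; rewrite /h {1}fimfunE fsbig_finite//= mulr_suml.
  apply: eq_bigr => r _; rewrite -mulrA; congr (_ * _).
  by rewrite !indicE -natrM mulnb -in_setI.
apply: (dominated_cvg_Rintegral_eq0 (f_ := fun n x => xi x * h n x)
  (g := fun x => `|xi x * k x| + `|xi x|)).
- move=> n; apply: measurable_funM; first exact: measurable_of_integrable ixi.
  by apply: measurable_funM; apply: measurableT_comp => //; exact: measurable_indic.
- move=> x; apply: cvgMr.
  have gk : g_ n (k x) @[n --> \oo] --> k x.
    by have /fine_cvgP[_] := g_cvg (k x) I; exact.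
  have : \forall n \near \oo, `|k x - g_ n (k x)| < 1.
    by move/cvgrPdist_lt: gk; apply.
  move=> near1; apply: cvg_trans gk; apply: near_eq_cvg.
  near=> n; rewrite /h indicE mem_set ?mulr1//= /A /= distrC ltW//.
  by near: n.
- move=> n x; rewrite !(normrM (xi x)) -[X in _ + X]mulr1 -mulrDr ler_wpM2l// /h indicE.
  have [gA|_] := boolP (k x \in A n); last by rewrite /= mulr0 normr0 addr_ge0.
  rewrite /= mulr1 -{1}(subrK (k x) (g_ n (k x))) addrC (le_trans (ler_normD _ _))//.
  by rewrite lerD2l; exact: set_mem gA.
- by apply: integrableD_EFin; exact: integrable_norm_EFin.
- by move=> n; exact: cl0.
Unshelve. all: by end_near. Qed.

End orthogonality.

(** * Conditional probabilities *)

Section conditional_probability.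
Context {d : measure_display} {T : measurableType d} {R : realType}.
Variable P : probability T R.

Local Notation itg f := (P.-integrable [set: T] (EFin \o f)).

Lemma ae_notin_of_integral_le0 (H : set T) (g : T -> R) :
  measurable H -> itg g -> (forall x, H x -> 0 < g x) ->
  (\int[P]_(x in H) (g x)%:E <= 0)%E -> {ae P, forall x, ~ H x}.
Proof.
move=> mH ig g0 intg0.
have mg : measurable_fun H (EFin \o g).
  by apply: measurable_funTS; exact: measurable_int ig.
have : (\int[P]_(x in H) `|(EFin \o g) x| = 0)%E.
  apply/eqP; rewrite eq_le integral_ge0// andbT.
  rewrite (eq_integral (EFin \o g))// => x /set_mem Hx.
  by rewrite /= gtr0_norm// g0.
move=> /(ae_eq_integral_abs P mH mg).
apply: filterS => x /= gx0 Hx; have := g0 _ Hx.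
by case: (gx0 Hx) => ->; rewrite ltxx.
Qed.

Variable G : set (set T).
Hypothesis GT : G [set: T].
Hypothesis G_measurable : G `<=` measurable.

Let G_measurable_fun (k : T -> R) :
  (forall B, measurable B -> G (k @^-1` B)) -> measurable_fun [set: T] k.
Proof. by move=> Gk _ B mB; rewrite setTI; apply: G_measurable; exact: Gk. Qed.

(** On [f < 0] the integral of [f] is a probability, and on [f > 1] that of [f - 1] is at most 0, so
    both events are null and clipping changes [f] on a null set only. Bounded versions make all
    later products integrable. *)
Lemma cond_prob_clip (E : set T) (f : T -> R) :
  measurable E -> is_cond_prob P G E f ->
  exists f', [/\ is_cond_prob P G E f', forall x, 0 <= f' x <= 1
    & {ae P, forall x, f' x = f x}].
Proof.
move=> mE [Gf itf intf]; pose clip (y : R) := Num.max 0 (Num.min 1 y).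
have mf := G_measurable_fun Gf.
have mclip : measurable_fun [set: R] clip.
  by apply: measurable_maxr => //; exact: measurable_minr.
have ae0 : {ae P, forall x, ~ (f @^-1` `]-oo, 0[) x}.
  have GH : G (f @^-1` `]-oo, 0[) by exact: Gf.
  apply: (ae_notin_of_integral_le0 (g := fun x => -1 * f x)).
  - exact: G_measurable.
  - exact: integrableZ_EFin.
  - by move=> x /=; rewrite in_itv/= mulN1r oppr_gt0.
  - under eq_integral do rewrite EFinM.
    rewrite integralZl//; last 2 first.
    + exact: G_measurable.
    + by apply: integrableS itf => //; exact: G_measurable.
    by rewrite intf// EFinN mulN1e oppe_le0.
have ae1 : {ae P, forall x, ~ (f @^-1` `]1, +oo[) x}.
  have GH : G (f @^-1` `]1, +oo[) by exact: Gf.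
  have mH := G_measurable GH.
  apply: (ae_notin_of_integral_le0 (g := fun x => f x - 1)).
  - exact: G_measurable.
  - by apply: integrableB_EFin => //; exact: integrable_cst_EFin.
  - by move=> x /=; rewrite in_itv/= andbT subr_gt0.
  - rewrite integralB_EFin//; last 2 first.
    + exact: integrableS itf.
    + by apply: (integrableS measurableT) => //; exact: integrable_cst_EFin.
    rewrite intf//= integral_cst// mul1e sube_le0.
    by rewrite le_measure// ?inE//; exact: measurableI.
have aef : {ae P, forall x, clip (f x) = f x}.
  apply: filterS2 ae0 ae1 => x /= /negP + /negP.
  rewrite !in_itv/= andbT -!leNgt => f0 f1.
  by rewrite /clip (min_idPr f1) (max_idPr f0).
have clip01 y : 0 <= clip y <= 1.
  by rewrite /clip le_max lexx/= ge_max ler01 ge_min lexx.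
exists (clip \o f); split; [split|by move=> x; exact: clip01|by []].
- by move=> B mB; rewrite comp_preimage; apply: Gf; rewrite -[_ @^-1` _]setTI; exact: mclip.
- apply: (integrable_bounded 1); first exact: measurableT_comp.
  by move=> x; have /andP[? ?] := clip01 (f x); rewrite ger0_norm.
- move=> H GH; rewrite -intf//; apply: ae_eq_integral.
  + exact: G_measurable.
  + by apply/measurable_EFinP/measurable_funTS; exact: measurableT_comp.
  + by apply/measurable_EFinP/measurable_funTS.
  + by apply: filterS aef => x /= -> .
Qed.

(** The defining property of [f] is orthogonality of [\1_E - f] to the indicators of events of [G];
    [Rintegral_orthogonal] extends it to [k]. *)
Lemma cond_prob_orthogonal (E : set T) (f k : T -> R) :
  measurable E -> is_cond_prob P G E f ->
  (forall B, measurable B -> G (k @^-1` B)) ->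
  P.-integrable [set: T] (EFin \o k) ->
  P.-integrable [set: T] (EFin \o (fun x => f x * k x)) ->
  \int[P]_x ((\1_E x - f x) * k x) = 0.
Proof.
move=> mE [Gf itf intf] Gk itk itfk.
have mk := G_measurable_fun Gk.
have m1E : measurable_fun [set: T] (\1_E : T -> R) by exact: measurable_indic.
have i1E : itg (\1_E : T -> R).
  apply: (integrable_bounded 1) => // x.
  by rewrite indicE; case: (_ \in _); rewrite ?normr1 ?normr0.
apply: (Rintegral_orthogonal (P := P)) => //.
- exact: integrableB_EFin.
- rewrite (_ : (fun x => _) = fun x => k x * \1_E x - f x * k x); last first.
    by apply/funext => x; ring.
  apply: integrableB_EFin => //; apply: (integrableM_bounded (C := 1)) => // x.
  by rewrite indicE; case: (_ \in _); rewrite ?normr1 ?normr0.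
- move=> B mB; have GH := Gk _ mB; have mH := G_measurable GH.
  set H := k @^-1` B in GH mH *.
  transitivity (\int[P]_(x in H) (\1_E x - f x)).
    rewrite [RHS]Rintegral_mkcond patch_indic.
    exact: eq_Rintegral.
  rewrite RintegralB//; last 2 first.
  + exact: integrableS i1E.
  + exact: integrableS itf.
  by rewrite /Rintegral intf// integral_indic// subrr.
Qed.

Let indic_le1 (E : set T) x : `|\1_E x : R| <= 1.
Proof. by rewrite indicE; case: (_ \in _); rewrite ?normr1 ?normr0. Qed.

Let measurable_preimage (k : T -> R) (B : set R) :
  measurable_fun [set: T] k -> measurable B -> measurable (k @^-1` B).
Proof. by move=> mk mB; rewrite -[_ @^-1` _]setTI; exact: mk. Qed.

(** It suffices to replace [X] by the indicator of an event [E] of [X]. Write [\1_E = xi + f] with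
    [f] a version of its conditional probability: [Y + L] is orthogonal to [f] by hypothesis, while
    [xi] is orthogonal to [L] by measurability and to [Y] by conditional independence. *)
Lemma cond_independent_orthogonal (X Y : {RV P >-> R}) (L : T -> R) :
  cond_independent G X Y ->
  (forall B, measurable B -> G (L @^-1` B)) ->
  itg Y -> itg L -> itg (fun x => (Y x + L x) * X x) ->
  (forall H, G H -> \int[P]_x ((Y x + L x) * \1_H x) = 0) ->
  \int[P]_x ((Y x + L x) * X x) = 0.
Proof.
move=> XY GL iY iL ieX e0.
have ie : itg (fun x => Y x + L x) by exact: integrableD_EFin.
have mX : measurable_fun [set: T] X by exact: measurable_funP.
have mY : measurable_fun [set: T] Y by exact: measurable_funP.
apply: Rintegral_orthogonal => // A mA.
set E := X @^-1` A; have mE : measurable E by exact: measurable_preimage.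
(* The choice [B = setT] serves to extract one version of the conditional probability of [E]. *)
have [f [_ [_ [Ef _ _ _]]]] := XY A setT mA measurableT.
have [{}f [{}Ef f01 _]] := cond_prob_clip mE Ef.
have [Gf itf _] := Ef.
have mf := G_measurable_fun Gf.
have normf x : `|f x| <= 1 by have /andP[? ?] := f01 x; rewrite ger0_norm.
pose xi x := \1_E x - f x.
have mxi : measurable_fun [set: T] xi.
  by apply: measurable_funB => //; exact: measurable_indic.
have normxi x : `|xi x| <= 1 + 1 by rewrite (le_trans (ler_normB _ _))// lerD.
have ixi : itg xi by exact: integrable_bounded mxi normxi.
have xiM k : itg k -> itg (fun x => xi x * k x).
  move=> ik; rewrite (_ : (fun x => _) = fun x => k x * xi x).
    exact: integrableM_bounded mxi normxi.
  by apply/funext => x; rewrite mulrC.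
have fM k : itg k -> itg (fun x => f x * k x).
  move=> ik; rewrite (_ : (fun x => _) = fun x => k x * f x).
    exact: integrableM_bounded mf normf.
  by apply/funext => x; rewrite mulrC.
have xiL : \int[P]_x (xi x * L x) = 0.
  by apply: cond_prob_orthogonal => //; exact: fM.
have xiY : \int[P]_x (xi x * Y x) = 0.
  apply: Rintegral_orthogonal => // [|B mB]; first exact: xiM.
  set F := Y @^-1` B; have mF : measurable F by exact: measurable_preimage.
  have [f0 [g0 [h [Ef0 Fg0 EFh hfg]]]] := XY A B mA mB.
  have [f2 [Ef2 f201 f2E]] := cond_prob_clip mE Ef0.
  have [g [Fg g01 gE]] := cond_prob_clip mF Fg0.
  have [Gf2 itf2 _] := Ef2.
  have [Gg itg_ _] := Fg.
  have mg := G_measurable_fun Gg.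
  have normg x : `|g x| <= 1 by have /andP[? ?] := g01 x; rewrite ger0_norm.
  have i1E : itg (\1_E : T -> R) by apply: (integrable_bounded 1).
  have i1F : itg (\1_F : T -> R) by apply: (integrable_bounded 1).
  have iEg : itg (fun x => \1_E x * g x) by exact: integrableM_bounded mg normg.
  have if2g : itg (fun x => f2 x * g x) by exact: integrableM_bounded mg normg.
  have ifg : itg (fun x => f x * g x) by exact: integrableM_bounded mg normg.
  have ifF : itg (fun x => f x * \1_F x) by exact: fM.
  have iEF : itg (fun x => \1_E x * \1_F x) by apply: (integrableM_bounded i1E).
  have igf : itg (fun x => g x * f x) by exact: integrableM_bounded mf normf.
  (* The version [f2] depends on [B] and may differ from [f]. The two are compared through [\1_E]:
     the integrals of [\1_E * \1_F], [f2 * g], [\1_E * g], [f * g] and [f * \1_F] coincide in this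
     order. *)
  have E1 := cond_prob_orthogonal mE Ef Gg itg_ ifg.
  have E2 := cond_prob_orthogonal mE Ef2 Gg itg_ if2g.
  have E3 := cond_prob_orthogonal mF Fg Gf itf igf.
  have E4 : \int[P]_x (\1_E x * \1_F x) = \int[P]_x (f2 x * g x).
    transitivity (fine (P (E `&` F))).
      congr fine; rewrite -(setIT (E `&` F)) -integral_indic//; last exact: measurableI.
      by apply: eq_integral => x _; rewrite !indicE in_setI -natrM mulnb.
    have [_ ith intEF] := EFh.
    rewrite -(setIT (E `&` F)) -intEF//; congr fine.
    apply: ae_eq_integral => //.
    + exact: measurable_int ith.
    + exact: measurable_int if2g.
    + apply: filterS3 f2E gE hfg => x f2x gx hx _ /=.
      by rewrite hx f2x gx.
  move: E1 E2 E3.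
  under eq_Rintegral do rewrite mulrBl.
  rewrite RintegralB// => /eqP; rewrite subr_eq0 => /eqP E1.
  under eq_Rintegral do rewrite mulrBl.
  rewrite RintegralB// => /eqP; rewrite subr_eq0 => /eqP E2.
  under eq_Rintegral do rewrite mulrBl (mulrC (\1_F _)) (mulrC (g _)).
  rewrite RintegralB// => /eqP; rewrite subr_eq0 => /eqP E3.
  under eq_Rintegral do rewrite mulrBl.
  by rewrite RintegralB// E4 -E2 E1 -E3 subrr.
have xie : \int[P]_x (xi x * (Y x + L x)) = 0.
  under eq_Rintegral do rewrite mulrDr.
  by rewrite RintegralD ?xiY ?xiL ?addr0//; exact: xiM.
have ef : \int[P]_x ((Y x + L x) * f x) = 0.
  apply: Rintegral_orthogonal => //.
  - exact: integrableM_bounded mf normf.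
  - by move=> B mB; apply: e0; exact: Gf.
transitivity (\int[P]_x (xi x * (Y x + L x) + (Y x + L x) * f x)).
  by apply: eq_Rintegral => x _; rewrite /xi; ring.
rewrite RintegralD ?xie ?ef ?addr0//; first exact: xiM.
exact: integrableM_bounded mf normf.
Qed.

End conditional_probability.

(** * Gaussian laws *)

Section normal_law.
Context {R : realType}.
Implicit Types m s v : R.
Local Notation mu := (@lebesgue_measure R).

(** Change of variables along the Radon-Nikodym derivative, which equals [normal_pdf] almost
    everywhere since both have the same integral over every measurable set. *)
Lemma ge0_integral_normal_prob m s (f : R -> \bar R) :
  measurable_fun [set: R] f -> (forall x, 0 <= f x)%E ->
  (\int[normal_prob m s]_x f x = \int[mu]_x (f x * (normal_pdf m s x)%:E))%E.
Proof.
move=> mf f0; have dom := normal_prob_dominates m s.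
have mpdf : measurable_fun [set: R] (EFin \o normal_pdf m s).
  by apply/measurable_EFinP; exact: measurable_normal_pdf.
rewrite -(Radon_Nikodym_SigmaFinite.change_of_variables dom)//.
have fint := Radon_Nikodym_SigmaFinite.f_integrable dom.
apply: ae_eq_integral => //.
- by apply: emeasurable_funM => //; exact: measurable_int fint.
- exact: emeasurable_funM.
- apply: ae_eqe_mul2l; apply: integral_ae_eq => //.
  by move=> E _ mE; rewrite -Radon_Nikodym_SigmaFinite.f_integral.
Qed.

Lemma integrable_normal_sqr :
  (normal_prob 0 1).-integrable [set: R] (EFin \o (fun x : R => x ^+ 2)).
Proof.
have msq : measurable_fun [set: R] (fun x : R => x ^+ 2) by exact: measurable_funX.
apply/integrableP; split; first exact/measurable_EFinP.
under eq_integral do rewrite /= ger0_norm ?sqr_ge0//.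
rewrite ge0_integral_normal_prob//; last 2 first.
  exact/measurable_EFinP.
  by move=> x; rewrite lee_fin sqr_ge0.
(* [K] times the density of standard deviation 2 dominates [x ^+ 2] times the standard one: the
   exponents differ by [3 / 8 * x ^+ 2], and [x ^+ 2 <= 4 * (1 + 3 / 8 * x ^+ 2)]. *)
pose K : R := 4 * normal_peak 1 / normal_peak 2.
have p1 : 0 < normal_peak (1 : R) by exact: normal_peak_gt0.
have p2 : 0 < normal_peak (2 : R) by exact: normal_peak_gt0.
apply: (@le_lt_trans _ _ (\int[mu]_x (K%:E * (normal_pdf 0 2 x)%:E)))%E.
  apply: ge0_le_integral => //.
  - by move=> x _; rewrite lee_fin mulr_ge0 ?sqr_ge0 ?normal_pdf_ge0.
  - apply: emeasurable_funM; first exact/measurable_EFinP.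
    by apply/measurable_EFinP; exact: measurable_normal_pdf.
  - apply: emeasurable_funM => //.
    by apply/measurable_EFinP; exact: measurable_normal_pdf.
  - move=> x _; rewrite -!EFinM lee_fin !normal_pdfE// /normal_fun subr0.
    rewrite (_ : K * _ = normal_peak 1 * (4 * expR (- x ^+ 2 / (2 ^+ 2 *+ 2)))); last first.
      by rewrite /K; field; rewrite gt_eqF.
    rewrite mulrCA ler_pM2l//.
    rewrite (_ : - x ^+ 2 / (1 ^+ 2 *+ 2) =
      - x ^+ 2 / (2 ^+ 2 *+ 2) - 3 / 8 * x ^+ 2); last by field.
    rewrite expRB mulrA ler_pdivrMr ?expR_gt0// [leRHS]mulrAC ler_pM2r ?expR_gt0//.
    have := expR_ge1Dx (3 / 8 * x ^+ 2); have := sqr_ge0 x; lra.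
rewrite integralZl//; last exact: integrable_normal_pdf.
by rewrite integral_normal_pdf mule1 ltry.
Qed.

(** Otherwise the law would be carried by [{0}], which is null because the law is dominated by
    Lebesgue measure. This lets the second moment be cancelled as a common factor. *)
Lemma normal_sqr_neq0 : \int[normal_prob 0 1]_x (x ^+ 2 : R) != 0.
Proof.
apply/eqP => int0.
have isq := integrable_normal_sqr.
have msq := measurable_int _ isq.
have : (\int[normal_prob (0 : R) 1]_x `|(EFin \o (fun x : R => (x ^+ 2)%R)) x| = 0)%E.
  under eq_integral do rewrite /= ger0_norm ?sqr_ge0//.
  rewrite -[LHS]fineK; last exact: (integrable_fin_num measurableT isq).
  by rewrite [X in X%:E]int0.
move=> /(ae_eq_integral_abs _ measurableT msq) ae0.
have n1 : (@normal_prob R 0%R 1%R [set 0%R] = 0)%E.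
  have := normal_prob_dominates (0 : R) 1.
  move=> /null_content_dominatesP; apply => //; exact: lebesgue_measure_set1.
have ae1 : {ae normal_prob (0 : R) 1, forall x : R, x <> 0}.
  exists [set 0]; split => // x /= /contrapT ->//.
have [N [mN N0 NT]] : {ae normal_prob (0 : R) 1, forall x : R, False}.
  apply: filterS2 ae0 ae1 => x /= + x0 => /(_ I) [] /eqP.
  by rewrite sqrf_eq0 => /eqP.
have : (normal_prob (0 : R) 1 setT <= normal_prob (0 : R) 1 N)%E.
  by apply: le_measure; rewrite ?inE// => x _; exact: NT.
by rewrite probability_setT N0 lee_fin ler10.
Qed.

(** Both sides are finite measures in [A], so it is enough to compare them on the closed rays, a
    generating family stable under intersection; there it is a substitution in the integral of the
    density. *)
Lemma normal_prob_affine m s (A : set R) : 0 < s -> measurable A ->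
  normal_prob m s A = normal_prob 0 1 ((fun x => m + s * x) @^-1` A).
Proof.
move=> s0 mA; pose F (x : R^o) : R^o := m + s * x.
have mF : measurable_fun [set: R] F.
  by apply: measurable_funD => //; exact: measurable_funM.
pose mF' := isMeasurableFun.Build _ _ (measurableTypeR R) (measurableTypeR R) F mF.
pose F' : {mfun measurableTypeR R >-> measurableTypeR R} := HB.pack F mF'.
suff : normal_prob m s A = pushforward (normal_prob (0 : R) 1) F' A by [].
have mA' : (@RGenCInfty.G R).-sigma.-measurable A.
  by rewrite -RGenCInfty.measurableE.
(* Uniqueness of measures is stated for the trace of the generators on a set; on [setT] the trace is
   the family itself. *)
have HE : [set X | (@RGenCInfty.G R) X /\ X `<=` setT] = @RGenCInfty.G R.
  by apply/seteqP; split => [X []//|X GX]; split.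
have := @g_sigma_algebra_measure_unique_trace _ R (measurableTypeR R)
  (@RGenCInfty.G R) setT measurableT.
rewrite HE => /(_ _ _ (normal_prob m s) (pushforward (normal_prob 0 1) F')).
apply => //.
- by move=> _ [x ->].
- move=> _ _ [x ->] [y ->]; exists (Num.max x y).
  by apply/seteqP; split => z /=; rewrite !in_itv/= !andbT ge_max => /andP.
- transitivity (1%E : \bar R); first exact: probability_setT.
  exact/esym/(probability_setT (normal_prob 0 1)).
- move=> _ [t ->]; pose a := (t - m) / s.
  have -> : t = F a by rewrite /F /a; field; rewrite gt_eqF.
  have dF x : is_derive x (1 : R^o) F s.
    by rewrite /F; apply: is_derive_eq; rewrite add0r mul1r /GRing.scale/= mulr1.
  have F'E : F^`()%classic = cst s.
    by apply/funext => x; rewrite derive1E; apply: derive_val.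
  have F'a : F' @^-1` `[F a, +oo[%classic = `[a, +oo[%classic.
    by apply/seteqP; split => x /=; rewrite !in_itv/= !andbT /F lerD2l ler_pM2l.
  transitivity (normal_prob 0 1 `[a, +oo[%classic); last first.
    by rewrite -F'a.
  rewrite /normal_prob.
  have /= := @increasing_ge0_integration_by_substitutiony _ F (normal_pdf m s) a.
  move=> subst; apply: etrans (subst _ _ _ _ _ _ _ _) _ => {subst}.
  + by move=> x y _ _ xy; rewrite /F ltrD2l ltr_pM2l.
  + by rewrite F'E => x _; exact: cvg_cst.
  + by rewrite F'E; exact: is_cvg_cst.
  + by rewrite F'E; exact: is_cvg_cst.
  + split; first by move=> x _; exact: ex_derive.
    apply: cvg_at_right_filter; apply: cvgD; first exact: cvg_cst.
    by apply: cvgMr; exact: cvg_id.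
  + rewrite (_ : F = (fun x => x + m) \o (fun x => x * s)); last first.
      by apply/funext => x; rewrite /F /= addrC mulrC.
    by apply: cvg_comp (cvg_addrr m); apply: gt0_cvgMly => //; exact: cvg_id.
  + apply: continuous_subspaceT; apply: continuous_normal_pdf; rewrite gt_eqF//.
  + by move=> x _; exact: normal_pdf_ge0.
  + apply: eq_integral => x _; congr EFin; rewrite F'E /= !normal_pdfE ?gt_eqF//.
    rewrite /normal_peak /normal_fun /F (_ : s ^+ 2 * pi *+ 2 = s ^+ 2 * (pi *+ 2)); last by ring.
    rewrite expr1n mul1r sqrtrM ?sqr_ge0// sqrtr_sqr gtr0_norm// invfM.
    rewrite !fctE /= (_ : - (m + s * x - m) ^+ 2 / _ = - (x - 0) ^+ 2 / 2).
      by rewrite -[RHS]mul1r -[X in _ = X * _](mulVf (x := s)) ?gt_eqF//; ring.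
    by field; rewrite gt_eqF.
- by apply: (@le_lt_trans _ _ 1%E); rewrite ?ltry// probability_le1.
Qed.
End normal_law.

(** * Transfer of integrals between variables of equal law *)

Section same_law.
Context {d1 d2 : measure_display} {T1 : measurableType d1}
  {T2 : measurableType d2} {R : realType}.
Variables (m1 : {finite_measure set T1 -> \bar R})
  (m2 : {finite_measure set T2 -> \bar R}) (f1 : T1 -> R) (f2 : T2 -> R).
Hypothesis mf1 : measurable_fun [set: T1] f1.
Hypothesis mf2 : measurable_fun [set: T2] f2.
Hypothesis law : forall B, measurable B -> m1 (f1 @^-1` B) = m2 (f2 @^-1` B).

Let ge0_integral_law (g : R -> \bar R) : measurable_fun [set: R] g ->
  (forall y, 0 <= g y)%E ->
  (\int[m1]_x g (f1 x) = \int[m2]_x g (f2 x))%E.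
Proof.
move=> mg g0.
pose F1 : {mfun T1 >-> R} := HB.pack f1 (isMeasurableFun.Build _ _ _ _ f1 mf1).
pose F2 : {mfun T2 >-> R} := HB.pack f2 (isMeasurableFun.Build _ _ _ _ f2 mf2).
transitivity (\int[pushforward m1 F1]_y g y)%E.
  by rewrite ge0_integral_pushforward.
transitivity (\int[pushforward m2 F2]_y g y)%E.
  by apply: eq_measure_integral => B mB _; exact: law.
by rewrite ge0_integral_pushforward.
Qed.

Lemma integrable_law (phi : R -> R) : measurable_fun [set: R] phi ->
  m2.-integrable [set: T2] (EFin \o (phi \o f2)) ->
  m1.-integrable [set: T1] (EFin \o (phi \o f1)).
Proof.
move=> mphi /integrableP[_ phi_fin]; apply/integrableP; split.
  by apply/measurable_EFinP; exact: measurableT_comp.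
rewrite (ge0_integral_law (g := fun y => `|phi y|%:E))//.
by apply/measurable_EFinP; exact: measurableT_comp.
Qed.

(** The positive and negative parts transfer separately, each as an integral against the common
    image measure. *)
Lemma Rintegral_law (phi : R -> R) : measurable_fun [set: R] phi ->
  \int[m1]_x phi (f1 x) = \int[m2]_x phi (f2 x).
Proof.
move=> mphi; have mE : measurable_fun [set: R] (EFin \o phi) by exact/measurable_EFinP.
have := ge0_integral_law (measurable_funepos mE) (funepos_ge0 (EFin \o phi)).
have := ge0_integral_law (measurable_funeneg mE) (funeneg_ge0 (EFin \o phi)).
move=> neg pos; congr fine; rewrite integralE [RHS]integralE.
by congr (_ - _)%E; [move: pos|move: neg]; congr (_ = _);
  apply: eq_integral => x _; rewrite ?funeposE ?funenegE.
Qed.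

End same_law.

Section gaussian_vector_moments.
Context {d : measure_display} {T : measurableType d} {R : realType}.
Context {P : probability T R} {n : nat}.
Variables (V : 'I_n -> {RV P >-> R}) (mu : 'rV[R]_n) (Sigma : 'M[R]_n).
Hypothesis V_gaussian : gaussian_vector V mu Sigma.
Hypothesis Sigma_ge0 : forall t : 'rV[R]_n, 0 <= (t *m Sigma *m t^T) 0 0.

Let q (t : 'rV[R]_n) := (t *m Sigma *m t^T) 0 0.

Definition centered (t : 'rV[R]_n) (x : T) : R :=
  \sum_(i < n) t 0 i * V i x - (t *m mu^T) 0 0.

Lemma measurable_centered t : measurable_fun [set: T] (centered t).
Proof.
apply: measurable_funB => //; apply: measurable_sum => i.
exact: measurable_funM.
Qed.

(** Scaling the standard normal law treats all variances at once: for [q t = 0] the scaling is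
    constantly 0 and both sides are the Dirac mass at 0. *)
Lemma centered_law t (B : set R) : measurable B ->
  P (centered t @^-1` B) =
  normal_prob 0 1 ((fun y => Num.sqrt (q t) * y) @^-1` B).
Proof.
move=> mB; set m := (t *m mu^T) 0 0.
pose B' := (fun y => y - m) @^-1` B.
have mB' : measurable B'.
  by rewrite /B' -[_ @^-1` _]setTI; apply: measurable_funB.
transitivity (gauss_law m (q t) B').
  by rewrite -V_gaussian.
rewrite /gauss_law; case: eqVneq => [->|q0].
  rewrite sqrtr0 diracE.
  have -> : (fun y : R => 0 * y) @^-1` B = if m \in B' then setT else set0.
    have -> : (m \in B') = (0 \in B).
      by apply/idP/idP; rewrite !inE /B' /= subrr.
    apply/seteqP; split => y /=; rewrite mul0r.
      by move=> B0; rewrite mem_set.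
    by case: ifPn => //; rewrite inE.
  case: ifPn => _; first exact/esym/(probability_setT (normal_prob 0 1)).
  exact/esym/(measure0 (normal_prob 0 1)).
rewrite normal_prob_affine ?sqrtr_gt0 ?lt_def ?q0 ?Sigma_ge0//.
congr (normal_prob 0 1); apply/seteqP; split => y;
  by rewrite /B' /= addrAC subrr add0r.
Qed.

Let C := \int[normal_prob 0 1]_x (x ^+ 2 : R).

Lemma centered_sqr t :
  P.-integrable [set: T] (EFin \o (fun x => centered t x ^+ 2)) /\
  \int[P]_x (centered t x ^+ 2) = C * q t.
Proof.
have msq : measurable_fun [set: R] (fun x : R => x ^+ 2) by exact: measurable_funX.
have mscale : measurable_fun [set: R] (fun y : R => Num.sqrt (q t) * y).
  exact: measurable_funM.
have sqE (y : R) : (Num.sqrt (q t) * y) ^+ 2 = q t * y ^+ 2.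
  by rewrite exprMn sqr_sqrtr// Sigma_ge0.
have isq := integrable_normal_sqr (R := R).
split.
  apply: (@integrable_law _ _ _ _ _ P (normal_prob 0 1) (centered t)
     (fun y => Num.sqrt (q t) * y) (measurable_centered t) mscale
     (centered_law t) (fun x => x ^+ 2) msq).
  rewrite (_ : _ \o _ = EFin \o (fun y => q t * y ^+ 2)); last first.
    by apply/funext => y /=; rewrite sqE.
  exact: (integrableZ_EFin _ isq).
rewrite (@Rintegral_law _ _ _ _ _ P (normal_prob 0 1) (centered t)
     (fun y => Num.sqrt (q t) * y) (measurable_centered t) mscale
     (centered_law t) (fun x => x ^+ 2) msq).
under eq_Rintegral do rewrite sqE.
by rewrite RintegralZl// mulrC.
Qed.

Lemma centered_same_law t u (phi : R -> R) : q t = q u ->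
  measurable_fun [set: R] phi ->
  \int[P]_x phi (centered t x) = \int[P]_x phi (centered u x).
Proof.
move=> qtu mphi; apply: Rintegral_law => //.
- exact: measurable_centered.
- exact: measurable_centered.
- move=> B mB; apply: etrans (centered_law t mB) _.
  by rewrite qtu; exact/esym/centered_law.
Qed.

End gaussian_vector_moments.

(** * The slope of the sine at 0 *)

Section sin_slope.
Context {R : realType}.
Implicit Types x : R.

Lemma sin_mean_value x : exists2 c, `|c| <= `|x| & sin x = cos c * x.
Proof.
wlog x0 : x / 0 <= x => [pos|].
  have [/pos//|x0] := leP 0 x.
  have [|c cx sx] := pos (- x); first by rewrite oppr_ge0 ltW.
  exists c; first by rewrite -(normrN x).
  by apply: oppr_inj; rewrite -sinN sx mulrN.
have csin : {within `[0, x], continuous (@sin R)}.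
  by apply: continuous_subspaceT; exact: continuous_sin.
have [c] := MVT_segment x0 (fun y _ => is_derive_sin y) csin.
rewrite in_itv/= sin0 !subr0 => /andP[c0 cx] ->.
by exists c => //; rewrite !ger0_norm.
Qed.

Lemma normr_sin_le x : `|sin x| <= `|x|.
Proof.
have [c _ ->] := sin_mean_value x.
by rewrite normrM ler_piMl// ler_norml cos_geN1 cos_le1.
Qed.

(** By the mean value theorem the sequence is [cos (c n) * x] with [c n] tending to 0. *)
Lemma cvg_sin_slope x : n.+1%:R * sin (n.+1%:R^-1 * x) @[n --> \oo] --> x.
Proof.
pose y n : R := n.+1%:R^-1 * x.
have y0 : `|y n| @[n --> \oo] --> (0 : R).
  rewrite -(normr0 R) -(mul0r x); apply: cvg_norm.
  by apply: cvgMl; exact: cvg_harmonic.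
have /choice[c cP] : forall n, exists c, `|c| <= `|y n| /\ sin (y n) = cos c * y n.
  by move=> n; have [c ? ?] := sin_mean_value (y n); exists c.
have c0 : c n @[n --> \oo] --> (0 : R).
  apply/norm_cvg0P; apply: (squeeze_cvgr (f := fun=> 0) (h := fun n => `|y n|)) => //.
    by apply: nearW => n; rewrite normr_ge0; case: (cP n).
  exact: cvg_cst.
rewrite (_ : (fun n => _) = fun n => cos (c n) * x); last first.
  apply/funext => n; have [_] := cP n; rewrite /y => ->.
  by rewrite mulrCA (mulrA n.+1%:R) divff ?pnatr_eq0// mul1r.
rewrite -[X in _ --> X]mul1r -cos0; apply: cvgMl.
by apply: continuous_cvg => //; exact: continuous_cos.
Qed.

End sin_slope.

(** * Uncorrelatedness and orthogonality for Gaussian vectors *)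

Section gaussian_vector_orthogonality.
Context {d : measure_display} {T : measurableType d} {R : realType}.
Context {P : probability T R} {n : nat}.
Variables (V : 'I_n -> {RV P >-> R}) (mu : 'rV[R]_n) (Sigma : 'M[R]_n).
Hypothesis V_gaussian : gaussian_vector V mu Sigma.
Hypothesis Sigma_sym : Sigma^T = Sigma.
Hypothesis Sigma_ge0 : forall t : 'rV[R]_n, 0 <= (t *m Sigma *m t^T) 0 0.

Local Notation q t := ((t *m Sigma *m t^T) 0 0).
Local Notation cen := (centered V mu).
Local Notation itg f := (P.-integrable [set: T] (EFin \o f)).

Lemma centered_lin (s : R) t u x : cen (s *: t + u) x = s * cen t x + cen u x.
Proof.
have -> : cen (s *: t + u) x =
    \sum_(i < n) (s * (t 0 i * V i x) + u 0 i * V i x) -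
    (s * (t *m mu^T) 0 0 + (u *m mu^T) 0 0).
  rewrite /centered mulmxDl -scalemxAl; congr (_ - _); last by rewrite !mxE.
  by apply: eq_bigr => i _; rewrite !mxE; ring.
by rewrite big_split -mulr_sumr /= /centered; ring.
Qed.

Lemma quad_form_lin (s : R) (t u : 'rV[R]_n) :
  q (s *: t + u) = s ^+ 2 * q t + 2 * s * (t *m Sigma *m u^T) 0 0 + q u.
Proof.
have sym : u *m Sigma *m t^T = (t *m Sigma *m u^T)^T.
  by rewrite !trmx_mul trmxK Sigma_sym mulmxA.
have symE : (u *m Sigma *m t^T) 0 0 = (t *m Sigma *m u^T) 0 0.
  by rewrite sym mxE.
rewrite linearD/= linearZ/= !mulmxDl !mulmxDr -!scalemxAl -!scalemxAr.
move: symE; move: (u *m _ *m _) (t *m _ *m _) => a b; rewrite !mxE => ->.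
by ring.
Qed.

Lemma integrable_centered t : itg (cen t).
Proof.
have [isq _] := centered_sqr V_gaussian Sigma_ge0 t.
apply: (le_integrable_EFin (g := fun x => cen t x ^+ 2 + 1)).
- exact: measurable_centered.
- move=> x; rewrite -real_normK ?num_real//.
  have := sqr_ge0 (`|cen t x| - 1); have := normr_ge0 (cen t x); nra.
- by apply: integrableD_EFin => //; exact: integrable_cst_EFin.
Qed.

Lemma integrable_centeredM t u : itg (fun x => cen t x * cen u x).
Proof.
have [isqt _] := centered_sqr V_gaussian Sigma_ge0 t.
have [isqu _] := centered_sqr V_gaussian Sigma_ge0 u.
apply: (le_integrable_EFin (g := fun x => cen t x ^+ 2 + cen u x ^+ 2)).
- by apply: measurable_funM; exact: measurable_centered.
- move=> x; rewrite normrM -(real_normK (num_real (cen t x))) -(real_normK (num_real (cen u x))).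
  have := sqr_ge0 (`|cen t x| - `|cen u x|).
  have := normr_ge0 (cen t x); have := normr_ge0 (cen u x); nra.
- exact: integrableD_EFin.
Qed.

(** Polarization: the second moment of [t + u] is the sum of those of [t] and [u]. Each is the same
    nonzero constant times the quadratic form, so the cross term of the form vanishes. *)
Lemma centered_uncorrelated t u : \int[P]_x (cen t x * cen u x) = 0 ->
  (t *m Sigma *m u^T) 0 0 = 0.
Proof.
move=> tu0.
have [isqt sqt] := centered_sqr V_gaussian Sigma_ge0 t.
have [isqu squ] := centered_sqr V_gaussian Sigma_ge0 u.
have [_ sqtu] := centered_sqr V_gaussian Sigma_ge0 (1 *: t + u).
have itu := integrable_centeredM t u.
have : \int[P]_x (cen (1 *: t + u) x ^+ 2) =
    \int[P]_x (2 * (cen t x * cen u x) + (cen t x ^+ 2 + cen u x ^+ 2)).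
  by apply: eq_Rintegral => x _; rewrite centered_lin; ring.
rewrite RintegralD//; last 2 first.
- exact: integrableZ_EFin.
- exact: integrableD_EFin.
rewrite RintegralZl// tu0 mulr0 add0r RintegralD// sqt squ sqtu.
rewrite -mulrDr => /(mulfI (@normal_sqr_neq0 R)).
rewrite quad_form_lin; lra.
Qed.

Lemma centered_orthogonal (r : 'rV[R]_n) (W : {set 'I_n}) (H : set T) :
  (forall i, i \in W -> (r *m Sigma) 0 i = 0) -> sigma_gen V W H ->
  \int[P]_x (cen r x * \1_H x) = 0.
Proof.
move=> rW VH; apply: (fourier_orthogonal (V := fun i => V i)) VH => //.
  exact: integrable_centered.
move=> w theta.
(* Extending [w] by zero turns the sum over [W] into [cen u] plus a mean, which [theta'] absorbs. *)
pose u : 'rV[R]_n := \row_i (if i \in W then w i else 0).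
pose theta' := theta + (u *m mu^T) 0 0.
pose f x := cos (cen u x + theta').
have normf x : `|f x| <= 1 by rewrite ler_norml cos_geN1 cos_le1.
have fE x : cos (\sum_(i in W) w i * V i x + theta) = f x.
  rewrite /f /theta' /centered; congr cos.
  rewrite (big_mkcond (fun i => i \in W)) /=.
  rewrite (eq_bigr (fun i => u 0 i * V i x)); first by ring.
  by move=> i _; rewrite mxE; case: ifP => // _; rewrite mul0r.
under eq_Rintegral do rewrite fE.
have mf : measurable_fun [set: T] f.
  apply: (measurableT_comp (f := cos)).
    by apply: continuous_measurable_fun; exact: continuous_cos.
  by apply: measurable_funD => //; exact: measurable_centered.
have msin : measurable_fun [set: R] (@sin R).
  by apply: continuous_measurable_fun; exact: continuous_sin.
have mr := measurable_centered V mu r.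
have ru : (r *m Sigma *m u^T) 0 0 = 0.
  rewrite mxE big1// => i _; rewrite !mxE; case: ifP => iW; last by rewrite mulr0.
  by have := rW i iW; rewrite mxE => ->; rewrite mul0r.
have msc (s : R) : measurable_fun [set: T] (fun x => sin (s * cen r x)).
  by apply: (measurableT_comp msin); exact: measurable_funM.
(* [s r + u] and [- s r + u] have the same variance since [r Sigma u^T = 0]. *)
have sin0 s : \int[P]_x (f x * sin (s * cen r x)) = 0.
  have qE : q (s *: r + u) = q (- s *: r + u).
    by rewrite !quad_form_lin ru; ring.
  pose phi y := sin (y + theta').
  have mphi : measurable_fun [set: R] phi.
    by apply: (measurableT_comp msin); exact: measurable_funD.
  have := centered_same_law V_gaussian Sigma_ge0 qE mphi => /eqP.
  have iphi t : itg (fun x => phi (cen t x)).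
    apply: (integrable_bounded 1); last by move=> x; exact: sin_max.
    by apply: (measurableT_comp mphi); exact: measurable_centered.
  rewrite -subr_eq0 -RintegralB//.
  (* [sin (y + z) - sin (y - z) = 2 cos y sin z] with [y = cen u x + theta'] and
     [z = s * cen r x]. *)
  rewrite (@eq_Rintegral _ _ _ _ _ (fun x => 2 * (f x * sin (s * cen r x)))); last first.
    move=> x _; rewrite /phi /f !centered_lin mulNr.
    move: (cen u x) (s * cen r x) => a b.
    by rewrite -!addrA (sinD b) (sinD (- b)) sinN cosN; ring.
  rewrite RintegralZl//; first by rewrite mulf_eq0 pnatr_eq0 => /eqP.
  apply: (integrable_bounded 1); first exact: measurable_funM.
  by move=> x; rewrite normrM mulr_ile1// sin_max.
(* The limit [s -> 0] along [s = k.+1%:R^-1]; the rescaled sines are dominated by [|cen r x|]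
   because [|sin y| <= |y|]. *)
apply: (dominated_cvg_Rintegral_eq0
  (f_ := fun k x => k.+1%:R * (f x * sin (k.+1%:R^-1 * cen r x)))
  (g := fun x => `|cen r x|)).
- by move=> k; apply: measurable_funM => //; exact: measurable_funM.
- move=> x; under eq_fun do rewrite mulrCA; rewrite mulrC.
  by apply: cvgMr; exact: cvg_sin_slope.
- move=> k x; rewrite !normrM normr_nat.
  apply: (@le_trans _ _ (k.+1%:R * `|k.+1%:R^-1 * cen r x|)).
    by rewrite ler_pM2l// (le_trans _ (normr_sin_le _))// ler_piMl.
  by rewrite normrM normfV normr_nat mulrA divff ?pnatr_eq0// mul1r.
- by apply: integrable_norm_EFin; exact: integrable_centered.
- move=> k; rewrite RintegralZl// ?sin0 ?mulr0//.
  apply: (integrable_bounded 1); first exact: measurable_funM.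
  by move=> x; rewrite normrM mulr_ile1// sin_max.
Qed.

End gaussian_vector_orthogonality.

(** * Partial covariances *)

Section residuals.
Context {R : realType} {n : nat}.
Variables (Sigma : 'M[R]_n) (Z : {set 'I_n}).
Hypothesis Sigma_posdef : posdefmx Sigma.

(** Selection matrix: multiplying by [S] on the left keeps the rows indexed by [Z], and by [S^T] on
    the right the columns. *)
Let S : 'M[R]_(#|Z|, n) := \matrix_(i, j) (enum_val i == j)%:R.

Let mulmx_Str m (M : 'M[R]_(m, n)) i j : (M *m S^T) i j = M i (enum_val j).
Proof.
rewrite mxE (bigD1 (enum_val j))//= !mxE eqxx mulr1 big1 ?addr0// => k kj.
by rewrite !mxE eq_sym (negbTE kj) mulr0.
Qed.

Let mulSmx m (M : 'M[R]_(n, m)) i j : (S *m M) i j = M (enum_val i) j.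
Proof.
rewrite mxE (bigD1 (enum_val i))//= !mxE eqxx mul1r big1 ?addr0// => k ki.
by rewrite !mxE eq_sym (negbTE ki) mul0r.
Qed.

Let ZZ := S *m Sigma *m S^T.

(** A nonzero [x] in the kernel would give a nonzero [x *m S] on which the quadratic form of [Sigma]
    vanishes. *)
Let ZZ_unit : ZZ \in unitmx.
Proof.
rewrite -row_free_unit -kermx_eq0; apply/eqP/row_matrixP => i.
rewrite row0; apply/eqP/negPn/negP => x0; set x := row i _ in x0.
have xZZ : x *m ZZ = 0 by rewrite /x -row_mul mulmx_ker row0.
have xS0 : x *m S != 0.
  apply: contra x0 => /eqP xS0; apply/eqP.
  have <- : x *m S *m S^T = x.
    apply/rowP => j; rewrite mulmx_Str mxE (bigD1 j)//= [S _ _]mxE eqxx mulr1.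
    rewrite big1 ?addr0// => k kj.
    by rewrite [S _ _]mxE (inj_eq enum_val_inj) (negbTE kj) mulr0.
  by rewrite xS0 mul0mx.
have := Sigma_posdef.2 _ xS0.
rewrite trmx_mul !mulmxA -(mulmxA x S) -(mulmxA x (S *m Sigma)) -/ZZ xZZ.
by rewrite mul0mx mxE ltxx.
Qed.

(** [r] holds the coefficients of the residual of [V_u] after linear regression on [V_Z], with [b]
    the regression coefficients; it turns partial covariances into entries of a plain product. *)
Lemma residual_exists (u : 'I_n) : exists r : 'rV[R]_n,
  [/\ forall i, i \notin Z -> r 0 i = (i == u)%:R,
      forall i, i \in Z -> (r *m Sigma) 0 i = 0
    & forall v, partial_cov Sigma Z u v = (r *m Sigma) 0 v].
Proof.
pose e : 'rV[R]_n := delta_mx 0 u.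
pose b := e *m Sigma *m S^T *m invmx ZZ.
have rowE v : (e *m Sigma) 0 v = Sigma u v by rewrite -rowE mxE.
exists (e - b *m S); split.
- move=> i iZ; rewrite !mxE eqxx andTb big1 ?subr0// => j _; rewrite !mxE.
  case: eqP => [ji|]; last by rewrite mulr0.
  by move: iZ; rewrite -ji enum_valP.
- move=> i iZ; have -> : i = enum_val (enum_rank_in iZ i) by rewrite enum_rankK_in.
  rewrite -mulmx_Str !mulmxBl -!(mulmxA b) -/ZZ /b mulmxKV//.
  by rewrite subrr mxE.
- move=> v; rewrite mulmxBl mxE rowE /partial_cov.
  rewrite [in RHS]mxE; congr (_ - _).
  have -> : \row_(j < #|Z|) Sigma u (enum_val j) = e *m Sigma *m S^T.
    by apply/rowP => j; rewrite mulmx_Str rowE mxE.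
  have -> : \matrix_(i < #|Z|, j < #|Z|) Sigma (enum_val i) (enum_val j) = ZZ.
    by apply/matrixP => i j; rewrite mulmx_Str mulSmx mxE.
  rewrite -/b -(mulmxA b) [LHS]mxE [RHS]mxE; apply: eq_bigr => i _; congr (_ * _).
  by rewrite mulSmx mxE.
Qed.

End residuals.

(** * Sigma-algebras generated by components *)

Lemma sigma_gen_measurable (d : measure_display) (T : measurableType d)
    (R : realType) (P : probability T R) (n : nat)
    (V : 'I_n -> {RV P >-> R}) (W : {set 'I_n}) :
  sigma_gen V W `<=` measurable.
Proof.
apply: smallest_sub; first exact: sigma_algebra_measurable.
by move=> _ [i _ [B mB <-]]; exact: measurable_funP.
Qed.

Lemma sigma_gen_sum (d : measure_display) (T : measurableType d)
    (R : realType) (P : probability T R) (n : nat)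
    (V : 'I_n -> {RV P >-> R}) (W : {set 'I_n}) (w : 'I_n -> R) (m : R)
    (B : set R) : measurable B ->
  sigma_gen V W ((fun x => \sum_(i in W) w i * V i x + m) @^-1` B).
Proof.
move=> mB; set GS := \bigcup_(i in [set` W]) g_sigma_algebra_preimage (V i).
(* The same space with the smaller sigma-algebra, so that the usual measurability rules prove
   membership in it. *)
pose TW := g_sigma_algebraType GS.
suff : measurable_fun [set: TW] (fun x : TW => \sum_(i in W) w i * V i x + m).
  by move=> /(_ measurableT B mB); rewrite setTI.
apply: measurable_funD => //.
have -> : (fun x : TW => \sum_(i in W) w i * V i x) =
    (fun x : TW => \sum_(i <- index_enum 'I_n) (if i \in W then w i * V i x else 0)).
  by apply/funext => x; rewrite (big_mkcond (fun i => i \in W)).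
apply: measurable_sum => i; have [iW|//] := boolP (i \in W).
apply: measurable_funM => //.
move=> _ A mA; apply: sub_sigma_algebra; exists i => //.
by exists A.
Qed.

(** [e = V a + L] with [L] a function of [V_W], and [e] is orthogonal to all events of [V_W].
    Conditional independence then makes [e] orthogonal to [V k], which is a zero covariance. *)
Lemma gaussian_cond_independent (d : measure_display) (T : measurableType d)
    (R : realType) (P : probability T R) (n : nat) (V : 'I_n -> {RV P >-> R})
    (mu : 'rV[R]_n) (Sigma : 'M[R]_n) (a k : 'I_n) (W : {set 'I_n})
    (r : 'rV[R]_n) :
  posdefmx Sigma -> gaussian_vector V mu Sigma -> a \notin W ->
  (forall i, i \notin W -> r 0 i = (i == a)%:R) ->
  (forall i, i \in W -> (r *m Sigma) 0 i = 0) ->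
  cond_independent (sigma_gen V W) (V k) (V a) -> (r *m Sigma) 0 k = 0.
Proof.
move=> [Sigma_sym Sigma_gt0] Vg aW rW rSW indep.
have Sigma_ge0 (t : 'rV[R]_n) : 0 <= (t *m Sigma *m t^T) 0 0.
  have [->|t0] := eqVneq t 0; last exact: ltW (Sigma_gt0 _ t0).
  by rewrite !mul0mx mxE.
pose e := centered V mu r.
pose L x : R := \sum_(i in W) r 0 i * V i x + - (r *m mu^T) 0 0.
have eE x : e x = V a x + L x.
  rewrite /e /centered /L addrA; congr (_ - _).
  rewrite (bigID (fun i => i \in W)) /= addrC; congr (_ + _).
  rewrite (bigD1 a)//= rW// eqxx mul1r big1 ?addr0// => i /andP[iW ia].
  by rewrite rW// (negbTE ia) mul0r.
have ie : P.-integrable [set: T] (EFin \o e) by exact: integrable_centered Vg Sigma_ge0 r.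
(* Unit vectors present each component as a centered combination plus its mean, which gives access
   to its moments. *)
pose dl i : 'rV[R]_n := delta_mx 0 i.
have VE i x : V i x = centered V mu (dl i) x + (dl i *m mu^T) 0 0.
  rewrite /centered subrK (bigD1 i)//= mxE !eqxx mul1r big1 ?addr0// => j ji.
  by rewrite mxE (negbTE ji) andbF mul0r.
have iV i : P.-integrable [set: T] (EFin \o V i).
  rewrite (_ : EFin \o _ = EFin \o (fun x => centered V mu (dl i) x + (dl i *m mu^T) 0 0)).
    apply: integrableD_EFin; last exact: integrable_cst_EFin.
    exact: integrable_centered Vg Sigma_ge0 _.
  by apply/funext => x /=; rewrite -VE.
have iL : P.-integrable [set: T] (EFin \o L).
  rewrite (_ : EFin \o _ = EFin \o (fun x => e x - V a x)); first exact: integrableB_EFin.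
  by apply/funext => x /=; rewrite eE addrAC subrr add0r.
have ieV : P.-integrable [set: T] (EFin \o (fun x => e x * V k x)).
  rewrite (_ : EFin \o _ = EFin \o (fun x =>
      e x * centered V mu (dl k) x + (dl k *m mu^T) 0 0 * e x)).
    apply: integrableD_EFin; last exact: integrableZ_EFin.
    exact: integrable_centeredM Vg Sigma_ge0 _ _.
  by apply/funext => x /=; rewrite VE; congr EFin; ring.
have GT : sigma_gen V W setT.
  by rewrite -setC0 -setTD; apply: sigma_algebraCD; exact: sigma_algebra0.
have e0 H : sigma_gen V W H -> \int[P]_x (e x * \1_H x) = 0.
  exact: (centered_orthogonal Vg Sigma_sym Sigma_ge0 rSW).
have ek : \int[P]_x (e x * V k x) = 0.
  under eq_Rintegral do rewrite eE.
  apply: (cond_independent_orthogonal GT (@sigma_gen_measurable _ _ _ _ _ V W) indep) => //.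
  - by move=> B mB; exact: sigma_gen_sum.
  - by under eq_fun do rewrite -eE.
  - by move=> H GH; under eq_Rintegral do rewrite -eE; exact: e0.
suff : (r *m Sigma *m (dl k)^T) 0 0 = 0.
  by rewrite trmx_delta -colE mxE.
apply: (centered_uncorrelated Vg Sigma_sym Sigma_ge0); rewrite -/e.
(* The event [setT] shows that [e] has mean 0, so centering [V k] does not change the integral. *)
have e1 : \int[P]_x e x = 0.
  rewrite -(e0 setT)//.
  by apply: eq_Rintegral => x _; rewrite indicT mulr1.
transitivity (\int[P]_x (e x * V k x - (dl k *m mu^T) 0 0 * e x)).
  by apply: eq_Rintegral => x _; rewrite VE; ring.
rewrite RintegralB//; last exact: integrableZ_EFin.
by rewrite RintegralZl// e1 mulr0 subr0.
Qed.

(** * Comparison of squared partial correlations *)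

Theorem theorem1 (d : measure_display) (T : measurableType d) (R : realType)
    (P : probability T R) (n : nat) (V : 'I_n -> {RV P >-> R})
    (mu : 'rV[R]_n) (Sigma : 'M[R]_n) (a c c' : 'I_n) (Z : {set 'I_n})
    (Sigma_posdef : posdefmx Sigma)
    (V_gaussian : gaussian_vector V mu Sigma)
    (c_neq_a : c != a) (c'_neq_a : c' != a)
    (a_notin_Z : a \notin Z) (c_notin_Z : c \notin Z) (c'_notin_Z : c' \notin Z)
    (c'_indep_a : cond_independent (sigma_gen V (c |: Z)) (V c') (V a)) :
  sq_partial_corr Sigma Z a c' <= sq_partial_corr Sigma Z a c.
Proof.
have [ra [raZ raS aE]] := residual_exists Z Sigma_posdef a.
have [rc [rcZ rcS cE]] := residual_exists Z Sigma_posdef c.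
have [rc' [rc'Z rc'S c'E]] := residual_exists Z Sigma_posdef c'.
pose form (x y : 'rV[R]_n) := (x *m Sigma *m y^T) 0 0.
(* In the product, indices of [Z] are killed by [x] and those outside [Z] other than [v] by [y]. On
   residuals the form is thus the partial covariance. *)
have formE (x y : 'rV[R]_n) v : v \notin Z -> (forall i, i \in Z -> (x *m Sigma) 0 i = 0) ->
    (forall i, i \notin Z -> y 0 i = (i == v)%:R) -> form x y = (x *m Sigma) 0 v.
  move=> vZ xZ yv; rewrite /form mxE (bigD1 v)//= [y^T _ _]mxE yv// eqxx mulr1.
  rewrite big1 ?addr0// => i iv; rewrite [y^T _ _]mxE.
  have [iZ|iZ] := boolP (i \in Z); first by rewrite xZ// mul0r.
  by rewrite yv// (negbTE iv) mulr0.
have res_gt0 (x : 'rV[R]_n) v : v \notin Z -> (forall i, i \notin Z -> x 0 i = (i == v)%:R) ->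
    0 < form x x.
  move=> vZ xv; apply: Sigma_posdef.2; apply/eqP => x0.
  by have := xv v vZ; rewrite x0 mxE eqxx => /eqP; rewrite eq_sym oner_eq0.
set p := partial_cov Sigma Z a c; set b := partial_cov Sigma Z c c.
set s := partial_cov Sigma Z c c'.
have b0 : 0 < b by rewrite /b cE -(formE rc rc)//; exact: res_gt0 rcZ.
have g0 : 0 < partial_cov Sigma Z c' c'.
  by rewrite c'E -(formE rc' rc')//; exact: res_gt0 rc'Z.
have a0 : 0 < partial_cov Sigma Z a a.
  by rewrite aE -(formE ra ra)//; exact: res_gt0 raZ.
have tE : partial_cov Sigma Z a c' = p / b * s.
  apply/eqP; rewrite -subr_eq0; apply/eqP.
  (* The coefficient makes the entry of [r *m Sigma] at [c] equal to [p - p / b * b = 0]. *)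
  pose r := ra - (p / b) *: rc.
  have rE i : (r *m Sigma) 0 i = (ra *m Sigma) 0 i - p / b * (rc *m Sigma) 0 i.
    by rewrite mulmxBl -scalemxAl !mxE.
  rewrite /s aE cE -rE.
  apply: (gaussian_cond_independent (a := a) (W := c |: Z) Sigma_posdef
    V_gaussian _ _ _ c'_indep_a).
  - by rewrite !inE eq_sym negb_or c_neq_a.
  - move=> i; rewrite !inE negb_or => /andP[ic iZ].
    by rewrite !mxE raZ// rcZ// (negbTE ic) mulr0 subr0.
  - move=> i; rewrite !inE rE => /orP[/eqP ->|iZ].
      by rewrite -aE -cE -/p -/b mulfVK ?subrr// gt_eqF.
    by rewrite raS// rcS// mulr0 subr0.
(* Cauchy-Schwarz, from the form at the residual of [c'] minus its regression on that of [c]. This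
   vector is zero when [c' = c], hence the case split. *)
have s2 : s ^+ 2 <= b * partial_cov Sigma Z c' c'.
  have : 0 <= form (- (s / b) *: rc + rc') (- (s / b) *: rc + rc').
    have [->|x0] := eqVneq (- (s / b) *: rc + rc') 0; last exact: ltW (Sigma_posdef.2 _ x0).
    by rewrite /form !mul0mx mxE.
  rewrite /form (quad_form_lin Sigma_posdef.1) -!/(form _ _).
  rewrite (formE rc rc c)// (formE rc rc' c')// (formE rc' rc' c')// -!cE -c'E -/b -/s.
  move: (partial_cov Sigma Z c' c') => ga; rewrite -(pmulr_rge0 _ b0) -(subr_ge0 (s ^+ 2)).
  by congr (0 <= _); field; rewrite gt_eqF.
rewrite /sq_partial_corr -/p -/b tE.
set al := partial_cov Sigma Z a a in a0 *.
set ga := partial_cov Sigma Z c' c' in g0 s2 *.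
(* With denominators cleared, both sides are [p ^+ 2 * al / b] times the two sides of [s2]. *)
rewrite ler_pdivrMr ?mulr_gt0// [leRHS]mulrAC ler_pdivlMr ?mulr_gt0//.
rewrite (_ : _ * (al * b) = p ^+ 2 * al / b * s ^+ 2); last by field; rewrite gt_eqF.
rewrite (_ : p ^+ 2 * (al * ga) = p ^+ 2 * al / b * (b * ga)); last by field; rewrite gt_eqF.
by rewrite ler_wpM2l// divr_ge0 ?(ltW b0)// mulr_ge0 ?sqr_ge0// ltW.
Qed.
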